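(* If a PTRS $\mathcal{P}$ admits infinite splits, then $\mathtt{PAST}(\xrightarrow{\mathbf{f}}_{\mathcal{P}})$ holds if and only if $\mathtt{SAST}(\xrightarrow{\mathbf{f}}_{\mathcal{P}})$ holds.
   Context: Terms $\mathcal{T}$ over countable signature and variables. $\mathrm{FDist}(A)$: finite multisets of pairs $(p:a)$, $0<p\le1$, probabilities summing to 1. A PTRS is a countable set $\mathcal{P}$ of rules $\ell\to\mu$, $\ell$ non-variable, $\mu\in\mathrm{FDist}(\mathcal{T})$, variables of terms in $\mu$ among those of $\ell$. $t\xrightarrow{\mathbf{f}}_{\mathcal{P}}\{p_1:t_1,\dots,p_k:t_k\}$ iff $t|_\pi=\ell\sigma$, $t_j=t[r_j\sigma]_\pi$ for position $\pi$, rule $\ell\to\{p_1:r_1,\dots,p_k:r_k\}$, substitution $\sigma$; normal forms admit no step. Lifting $\rightrightarrows$: smallest relation on multi-distributions with $\{1:t\}\rightrightarrows\{1:t\}$ for normal forms, $\{1:t\}\rightrightarrows\mu$ if $t\xrightarrow{\mathbf{f}}_{\mathcal{P}}\mu$, closed under $\bigcup_jp_j\cdot\mu_j\rightrightarrows\bigcup_jp_j\cdot\nu_j$ ($\sum p_j=1$). $|\mu|$: probability of normal forms in $\mu$; $\mathrm{edl}((\mu_n))=\sum_n(1-|\mu_n|)$. $\mathtt{PAST}$: every infinite $\rightrightarrows$-sequence with $\mu_0=\{1:t\}$ has finite $\mathrm{edl}$. $\mathtt{SAST}$: for every term $t$, $\sup\{\mathrm{edl}(\vec\mu)\mid\vec\mu$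 infinite $\rightrightarrows$-sequence with $\mu_0=\{1:t\}\}<\infty$. A $\xrightarrow{\mathbf{f}}_{\mathcal{P}}$-rewrite sequence tree (RST) is a (possibly infinite) directed tree in which every node has finitely many children, each node $v$ is labeled by a pair $(p_v:t_v)$ with $p_v\in(0,1]$ and $t_v\in\mathcal{T}$, the root has $p=1$, and for every node $v$ with children $w_1,\dots,w_k$ ($k\ge1$) we have $t_v\xrightarrow{\mathbf{f}}_{\mathcal{P}}\{\frac{p_{w_1}}{p_v}:t_{w_1},\dots,\frac{p_{w_k}}{p_v}:t_{w_k}\}$; leaves are nodes without children. $\mathcal{P}$ admits infinite splits if for every term $t$ there exist a term $t'$ and a $\xrightarrow{\mathbf{f}}_{\mathcal{P}}$-RST whose root is labeled $(1:t')$ having infinitely many leaves labeled with terms that contain $t$ as a subterm. *)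

(* Defs.v *)
From HB Require Import structures.
From mathcomp Require Import all_boot all_order all_algebra.
From mathcomp Require Import finmap multiset.
From mathcomp Require Import all_classical all_reals all_analysis.

Set Implicit Arguments.
Unset Strict Implicit.
Unset Printing Implicit Defensive.

Import Order.TTheory GRing.Theory Num.Theory.
Local Open Scope mset_scope.
Local Open Scope classical_set_scope.
Local Open Scope ring_scope.

Notation multidist R A := {mset (R * A)%type}.

Section Mdist.
Variables (R : realType) (A : choiceType).
Implicit Types (mu : multidist R A).

Definition is_fdist mu : Prop :=
  (forall x, x \in mu -> 0 < x.1 <= 1) /\ \sum_(x <- mu) x.1 = 1.

Definition md_dirac (a : A) : multidist R A := [mset (1, a)].

Definition md_scale (p : R) mu : multidist R A :=
  seq_mset [seq (p * x.1, x.2) | x <- mu].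

(* The union of multisets adds up multiplicities, hence [msetD]. *)
Definition md_union (k : nat) (p : 'I_k -> R) (mu : 'I_k -> multidist R A) :
    multidist R A :=
  \big[msetD/mset0]_(j < k) md_scale (p j) (mu j).

End Mdist.

Definition md_map (R : realType) (A B : choiceType) (f : A -> B)
    (mu : multidist R A) : multidist R B :=
  seq_mset [seq (x.1, f x.2) | x <- mu].

Section Termination.
Variables (R : realType) (A : choiceType) (step : A -> multidist R A -> Prop).

Definition normal_form (a : A) : Prop := ~ exists mu, step a mu.

Inductive lifting : multidist R A -> multidist R A -> Prop :=
| lifting_nf a : normal_form a -> lifting (md_dirac R a) (md_dirac R a)
| lifting_step a mu : step a mu -> lifting (md_dirac R a) mu
| lifting_union (k : nat) (p : 'I_k -> R) (mu nu : 'I_k -> multidist R A) :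
    (forall j, 0 < p j <= 1) -> \sum_(j < k) p j = 1 ->
    (forall j, lifting (mu j) (nu j)) ->
    lifting (md_union p mu) (md_union p nu).

Definition prob_nf (mu : multidist R A) : R :=
  \sum_(x <- mu | `[< normal_form x.2 >]) x.1.

Definition edl (mu : nat -> multidist R A) : \bar R :=
  (\sum_(0 <= n <oo) (1 - prob_nf (mu n))%:E)%E.

Definition lifting_sequence (mu : nat -> multidist R A) : Prop :=
  forall n, lifting (mu n) (mu n.+1).

Definition PAST : Prop :=
  forall (a : A) (mu : nat -> multidist R A),
    lifting_sequence mu -> mu 0%N = md_dirac R a -> (edl mu < +oo)%E.

Definition SAST : Prop :=
  forall a : A,
    (ereal_sup [set edl mu | mu in
       [set mu | lifting_sequence mu /\ mu 0%N = md_dirac R a]] < +oo)%E.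

End Termination.

Record signature := Signature { symbol :> countType; arity : symbol -> nat }.

Inductive term (Sg : signature) (V : countType) : Type :=
| Var of V
| App (f : Sg) of ('I_(arity f) -> term Sg V).

Arguments Var {Sg V} x.
Arguments App {Sg V} f args.

HB.instance Definition _ (Sg : signature) (V : countType) :=
  gen_eqMixin (term Sg V).
HB.instance Definition _ (Sg : signature) (V : countType) :=
  gen_choiceMixin (term Sg V).

Section Terms.
Variables (Sg : signature) (V : countType).
Notation term := (term Sg V).

Definition is_var (t : term) : bool := if t is Var _ then true else false.

Fixpoint vars (t : term) : set V :=
  match t with
  | Var x => [set x]
  | App f args => \bigcup_i vars (args i)
  end.

Fixpoint subst (s : V -> term) (t : term) : term :=
  match t with
  | Var x => s x
  | App f args => App f (fun i => subst s (args i))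
  end.

(* A position of a term is a list of argument indices, counted from 0. *)
Fixpoint subterm_at (t : term) (q : seq nat) {struct q} : option term :=
  match q, t with
  | [::], _ => Some t
  | _ :: _, Var _ => None
  | i :: q', App f args =>
      if insub i is Some j then subterm_at (args j) q' else None
  end.

(* Only meaningful when [q] is a position of [t]. *)
Fixpoint replace_at (t : term) (q : seq nat) (u : term) {struct q} : term :=
  match q, t with
  | [::], _ => u
  | _ :: _, Var _ => t
  | i :: q', App f args =>
      App f (fun j => if val j == i then replace_at (args j) q' u else args j)
  end.

Definition contains_subterm (s t : term) : Prop :=
  exists q, subterm_at s q = Some t.

End Terms.

Record PTRS (R : realType) (Sg : signature) (V : countType) := {
  rules :> set (term Sg V * multidist R (term Sg V));
  rules_countable : countable rules;
  rules_lhs : forall l mu, rules (l, mu) -> ~~ is_var l;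
  rules_fdist : forall l mu, rules (l, mu) -> is_fdist mu;
  rules_vars : forall l mu, rules (l, mu) ->
    forall x, x \in mu -> vars x.2 `<=` vars l
}.

Section Rewriting.
Variables (R : realType) (Sg : signature) (V : countType) (P : PTRS R Sg V).
Notation term := (term Sg V).

Definition fstep (t : term) (nu : multidist R term) : Prop :=
  exists (q : seq nat) (l : term) (mu : multidist R term) (s : V -> term),
    [/\ rules P (l, mu),
        subterm_at t q = Some (subst s l) &
        nu = md_map (fun r => replace_at t q (subst s r)) mu].

(* Up to isomorphism, a finitely branching tree is given by the number of
   children of each node, a node being the list of the child indices (counted
   from 0) on its path from the root. The fields are only relevant at
   the addresses satisfying [is_node]. *)
Record labeled_tree := LabeledTree {
  nchildren : seq nat -> nat;
  node_prob : seq nat -> R;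
  node_term : seq nat -> term
}.

Definition is_node (T : labeled_tree) (v : seq nat) : Prop :=
  forall i, (i < size v)%N -> (nth 0%N v i < nchildren T (take i v))%N.

Definition is_leaf (T : labeled_tree) (v : seq nat) : Prop :=
  is_node T v /\ nchildren T v = 0%N.

Definition children_dist (T : labeled_tree) (v : seq nat) : multidist R term :=
  seq_mset [seq (node_prob T (rcons v i) / node_prob T v,
                 node_term T (rcons v i)) | i <- iota 0 (nchildren T v)].

Definition is_RST (T : labeled_tree) : Prop :=
  [/\ node_prob T [::] = 1,
      forall v, is_node T v -> 0 < node_prob T v <= 1 &
      forall v, is_node T v -> (0 < nchildren T v)%N ->
        fstep (node_term T v) (children_dist T v)].

Definition admits_infinite_splits : Prop :=
  forall t : term, exists (t' : term) (T : labeled_tree),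
    [/\ is_RST T, node_term T [::] = t' &
        infinite_set
          [set v | is_leaf T v /\ contains_subterm (node_term T v) t]].

End Rewriting.

(* Main.v *)
Require Import Defs.
From mathcomp Require Import all_boot all_order all_algebra.
From mathcomp Require Import finmap multiset.
From mathcomp Require Import all_classical all_reals all_analysis.

Set Implicit Arguments.
Unset Strict Implicit.
Unset Printing Implicit Defensive.

Import Order.TTheory GRing.Theory Num.Theory.
Local Open Scope mset_scope.
Local Open Scope classical_set_scope.
Local Open Scope ring_scope.

(** Only PAST implies SAST needs an argument.  If [t] violates SAST, then for
    every bound [c] some finite strategy from [t] makes at least [c] proper
    steps in expectation, and the same holds for every term containing [t].
    Take a rewrite sequence tree with infinitely many leaves [v] containing
    [t], and continue at each such leaf with a strategy that makes
    [1 / node_prob T v] steps in expectation.  Each of them contributes 1 to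
    the expected derivation length from the root, so a single lifting sequence
    has infinite expected derivation length.  This sequence is obtained as the
    projection of a Markov chain on tree nodes and pending strategies. *)

(** * Multisets presented by sequences *)

Section MultisetSequences.
Variable K : choiceType.

Lemma seq_mset_cat (s1 s2 : seq K) :
  seq_mset (s1 ++ s2) = (seq_mset s1 `+` seq_mset s2)%mset.
Proof. by apply/msetP => x; rewrite msetE2 !mset_seqE count_cat. Qed.

Lemma seq_mset_flatten (I : Type) (r : seq I) (F : I -> seq K) :
  seq_mset (flatten [seq F i | i <- r]) =
  \big[msetD/mset0]_(i <- r) seq_mset (F i).
Proof.
elim: r => [|i r IH] /=; last by rewrite seq_mset_cat big_cons IH.
by rewrite big_nil; apply/msetP => x; rewrite mset0E mset_seqE.
Qed.

Lemma big_seq_mset (R : nmodType) (s : seq K) (F : K -> R) :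
  \sum_(x <- seq_mset s) F x = \sum_(x <- s) F x.
Proof. exact/perm_big/perm_eq_seq_mset. Qed.

Lemma mem_seq_mset (s : seq K) x : (x \in seq_mset s) = (x \in s).
Proof. exact/perm_mem/perm_eq_seq_mset. Qed.

End MultisetSequences.

(** * Expectation, union and sequential composition of multidistributions *)

Section Multidistributions.
Variable R : realType.

Definition expect (A : choiceType) (mu : multidist R A) (h : A -> R) : R :=
  \sum_(x <- mu) x.1 * h x.2.

(** Monadic composition: one transition of a Markov chain with kernel [f], applied to the law
    [mu]. *)
Definition md_bind (A B : choiceType) (mu : multidist R A)
    (f : A -> multidist R B) : multidist R B :=
  seq_mset (flatten [seq [seq (x.1 * y.1, y.2) | y <- f x.2] | x <- mu]).

Lemma md_map_seq_mset (A B : choiceType) (f : A -> B) (s : seq (R * A)) :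
  md_map f (seq_mset s) = seq_mset [seq (x.1, f x.2) | x <- s].
Proof. exact/eq_seq_msetP/perm_map/perm_eq_seq_mset. Qed.

Lemma md_map_comp (A B C : choiceType) (f : A -> B) (g : B -> C)
    (mu : multidist R A) :
  md_map g (md_map f mu) = md_map (g \o f) mu.
Proof. by rewrite md_map_seq_mset -map_comp. Qed.

Lemma md_map_dirac (A B : choiceType) (f : A -> B) (a : A) :
  md_map f (md_dirac R a) = md_dirac R (f a).
Proof.
rewrite /md_map /md_dirac enum_msetn /=.
by apply/msetP => x; rewrite mset_seqE /= addn0 msetnE eq_sym; case: eqP.
Qed.

Lemma md_unionE (A : choiceType) k (p : 'I_k -> R) (mu : 'I_k -> multidist R A) :
  md_union p mu =
  seq_mset (flatten [seq [seq (p j * x.1, x.2) | x <- mu j] | j <- index_enum 'I_k]).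
Proof. by rewrite seq_mset_flatten. Qed.

Lemma big_md_union (A : choiceType) k (p : 'I_k -> R)
    (mu : 'I_k -> multidist R A) (F : R * A -> R) :
  \sum_(x <- md_union p mu) F x = \sum_j \sum_(x <- mu j) F (p j * x.1, x.2).
Proof.
rewrite md_unionE big_seq_mset big_flatten big_map.
by apply: eq_bigr => j _; rewrite big_map.
Qed.

Section Expectation.
Variable A : choiceType.
Implicit Types (mu : multidist R A) (h : A -> R).

Lemma expect_dirac (a : A) h : expect (md_dirac R a) h = h a.
Proof. by rewrite /expect /md_dirac enum_msetn big_seq1 mul1r. Qed.

Lemma expect_union k (p : 'I_k -> R) (mu : 'I_k -> multidist R A) h :
  expect (md_union p mu) h = \sum_j p j * expect (mu j) h.
Proof.
rewrite /expect (big_md_union p mu (fun x => x.1 * h x.2)).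
by apply: eq_bigr => j _; rewrite mulr_sumr; apply: eq_bigr => x _; rewrite mulrA.
Qed.

Lemma expect_map (B : choiceType) (f : A -> B) mu (h : B -> R) :
  expect (md_map f mu) h = expect mu (h \o f).
Proof. by rewrite /expect big_seq_mset big_map. Qed.

Lemma expect_bind (B : choiceType) mu (f : A -> multidist R B) (h : B -> R) :
  expect (md_bind mu f) h = expect mu (fun a => expect (f a) h).
Proof.
rewrite /expect big_seq_mset big_flatten big_map.
apply: eq_bigr => x _; rewrite big_map mulr_sumr.
by apply: eq_bigr => y _; rewrite mulrA.
Qed.

Lemma expectD mu h1 h2 :
  expect mu (h1 \+ h2) = expect mu h1 + expect mu h2.
Proof. by rewrite -big_split; apply: eq_bigr => x _ /=; rewrite -mulrDr. Qed.

Lemma le_expect mu h1 h2 : is_fdist mu ->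
  (forall x, x \in mu -> h1 x.2 <= h2 x.2) -> expect mu h1 <= expect mu h2.
Proof.
move=> [mu0 _] h12; rewrite /expect big_seq [leRHS]big_seq.
apply: ler_sum => x xmu; apply: ler_wpM2l (h12 _ xmu).
by case/andP: (mu0 _ xmu) => /ltW.
Qed.

Lemma expect_ge0 mu h : is_fdist mu -> (forall a, 0 <= h a) -> 0 <= expect mu h.
Proof.
move=> muP h0; rewrite -[leLHS](_ : expect mu (fun=> 0) = 0).
  exact: le_expect.
by rewrite /expect big1 // => x _; rewrite mulr0.
Qed.

Lemma is_fdist_dirac (a : A) : is_fdist (md_dirac R a).
Proof.
split; first by move=> x; rewrite in_mset1 => /eqP ->; rewrite /= ltr01 lexx.
by rewrite /md_dirac enum_msetn big_seq1.
Qed.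

Lemma is_fdist_union k (p : 'I_k -> R) (mu : 'I_k -> multidist R A) :
  (forall j, 0 < p j <= 1) -> \sum_j p j = 1 -> (forall j, is_fdist (mu j)) ->
  is_fdist (md_union p mu).
Proof.
move=> p01 p1 muP; split=> [x|].
  rewrite md_unionE mem_seq_mset => /flatten_mapP[j _ /mapP[y ymu ->]] /=.
  have /andP[p0 ple1] := p01 j; have /andP[y0 yle1] := (muP j).1 _ ymu.
  by rewrite mulr_gt0 // mulr_ile1 // ltW.
rewrite (big_md_union p mu fst) /= -[RHS]p1; apply: eq_bigr => j _.
by rewrite -mulr_sumr (muP j).2 mulr1.
Qed.

(** Relabelling leaves the probabilities alone. The forward direction transfers validity from
    projected laws on terms back to laws on states. *)
Lemma is_fdist_map (B : choiceType) (f : A -> B) mu :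
  is_fdist (md_map f mu) <-> is_fdist mu.
Proof.
rewrite /is_fdist big_seq_mset big_map /=; split=> -[mu0 mu1]; split=> // x.
  by move=> xmu; apply: (mu0 (x.1, f x.2)); rewrite mem_seq_mset; apply/mapP; exists x.
by rewrite mem_seq_mset => /mapP[y /mu0 + ->].
Qed.

(** Brings [md_bind] into the ordinal-indexed form that [lifting_union] requires. *)
Lemma seq_mset_union (I : Type) (s : seq I) (p : I -> R) (f : I -> multidist R A) :
  seq_mset (flatten [seq [seq (p i * y.1, y.2) | y <- f i] | i <- s]) =
  md_union (fun j => p (tnth (in_tuple s) j)) (fun j => f (tnth (in_tuple s) j)).
Proof. by rewrite seq_mset_flatten big_tnth. Qed.

End Expectation.

Lemma md_bind_dirac (A B : choiceType) (f : A -> B) (mu : multidist R A) :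
  md_bind mu (fun a => md_dirac R (f a)) = md_map f mu.
Proof.
rewrite /md_bind /md_map; congr seq_mset.
elim: (enum_mset mu) => //= x s ->.
by rewrite /md_dirac enum_msetn /= mulr1.
Qed.

Lemma md_map_bind (A B C : choiceType) (g : B -> C) (mu : multidist R A)
    (f : A -> multidist R B) :
  md_map g (md_bind mu f) = md_bind mu (fun a => md_map g (f a)).
Proof.
rewrite md_map_seq_mset map_flatten -map_comp /md_bind !seq_mset_flatten.
apply: eq_bigr => x _ /=; apply/eq_seq_msetP.
rewrite -map_comp perm_sym.
have := perm_map (fun y : R * C => (x.1 * y.1, y.2))
  (perm_eq_seq_mset [seq (y.1, g y.2) | y <- f x.2]).
by rewrite -map_comp.
Qed.

End Multidistributions.

(** * Liftings, expected derivation length and achievable step counts *)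

Section AbstractReduction.
Variables (R : realType) (A : choiceType) (step : A -> multidist R A -> Prop).
Hypothesis step_fdist : forall a mu, step a mu -> is_fdist mu.

Definition reducible (a : A) : R := (~~ `[< normal_form step a >])%:R.

Lemma reducible_ge0 a : 0 <= reducible a.
Proof. exact: ler0n. Qed.

Lemma reducible_nf a : normal_form step a -> reducible a = 0.
Proof. by move=> nfa; rewrite /reducible asboolT. Qed.

Lemma reducible_step a mu : step a mu -> reducible a = 1.
Proof. by move=> st; rewrite /reducible asboolF // => -[]; exists mu. Qed.

Lemma expect_reducible mu : is_fdist mu ->
  expect mu reducible = 1 - prob_nf step mu.
Proof.
move=> [_ mu1]; apply/eqP; rewrite eq_sym subr_eq -{}mu1; apply/eqP.
rewrite /prob_nf [X in _ = _ + X]big_mkcond -big_split; apply: eq_bigr => x _ /=.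
by rewrite /reducible; case: ifP => _; rewrite /= ?(mulr0, mulr1, add0r, addr0).
Qed.

Lemma lifting_fdist mu nu : lifting step mu nu -> is_fdist mu /\ is_fdist nu.
Proof.
elim=> {mu nu} [a _|a mu /step_fdist ? |k p mu nu p01 p1 _ IH].
- by split; apply: is_fdist_dirac.
- by split; first apply: is_fdist_dirac.
- by split; apply: is_fdist_union => // j; case: (IH j).
Qed.

(** Both sides are unions with the same weights, those of [mu], so the closure rule of the lifting
    applies. *)
Lemma lifting_bind (S : choiceType) (mu : multidist R S)
    (f g : S -> multidist R A) : is_fdist mu ->
  (forall s, lifting step (f s) (g s)) ->
  lifting step (md_bind mu f) (md_bind mu g).
Proof.
move=> [mu01 mu1] fg; rewrite /md_bind !seq_mset_union.
apply: lifting_union => [j||j //].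
  by apply: mu01; apply: mem_tnth.
by rewrite -mu1 [RHS]big_tnth.
Qed.

Lemma lifting_total a : exists mu, lifting step (md_dirac R a) mu.
Proof.
have [[mu st]|nfa] := pselect (exists mu, step a mu).
  by exists mu; apply: lifting_step.
by exists (md_dirac R a); apply: lifting_nf.
Qed.

(* [achievable n a c]: some strategy makes the expected number of proper steps
   among the first [n] steps from [a] at least [c]. *)
Fixpoint achievable (n : nat) (a : A) (c : R) : Prop :=
  c <= 0 \/
  if n is n'.+1 then
    exists mu f, [/\ step a mu,
      forall x, x \in mu -> achievable n' x.2 (f x.2) & c <= 1 + expect mu f]
  else False.

Lemma achievable0 n a : achievable n a 0.
Proof. by case: n => [|n]; left. Qed.

Lemma achievableS n a c : achievable n a c -> achievable n.+1 a c.
Proof.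
elim: n a c => [|n IH] a c [c0|]; [by left|by []|by left|].
by move=> [mu [f [st fP cle]]]; right; exists mu, f; split=> // x /fP /IH.
Qed.

Lemma achievable_le n a c d : c <= d -> achievable n a d -> achievable n a c.
Proof.
move=> cd; case: n => [|n] [d0|//]; try by left; apply: le_trans d0.
by move=> [mu [f [st fP dle]]]; right; exists mu, f; split=> //; apply: le_trans dle.
Qed.

(** Prepends one lifting step to the strategies behind [g]. A term may occur in several components
    of a union and be continued differently in each; assigning it its best continuation loses
    nothing. *)
Lemma lifting_achievable mu nu : lifting step mu nu ->
  forall n (g : A -> R), (forall a, achievable n a (g a)) ->
  exists2 g', forall a, achievable n.+1 a (g' a) &
    expect mu reducible + expect nu g <= expect mu g'.
Proof.
elim=> {mu nu} [a nfa|a mu st|k p mu nu p01 p1 lft IH] n g gP.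
- exists g => [b|]; first exact: achievableS.
  by rewrite !expect_dirac reducible_nf // add0r.
(* Only the value at [a] enters the expectation; 0 is achievable everywhere else. *)
- exists (fun b => if b == a then 1 + expect mu g else 0) => [b|].
    case: eqP => [->|_]; last exact: achievable0.
    by right; exists mu, g; split.
  by rewrite !expect_dirac eqxx (reducible_step st).
- have /choice[g' g'P] : forall j, exists g' : A -> R,
      (forall a, achievable n.+1 a (g' a)) /\
      expect (mu j) reducible + expect (nu j) g <= expect (mu j) g'.
    by move=> j; have [g' ? ?] := IH j n g gP; exists g'.
  (* The pointwise maximum dominates every [g' j] and is itself one of the values [g' j a] or the
     achievable default 0. *)
  exists (fun a => \big[Num.max/0]_j g' j a) => [a|].
    elim/big_ind: _ => [|x y Hx Hy|j _]; first exact: achievable0.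
      by rewrite /Num.max; case: ifP.
    exact: (g'P j).1.
  rewrite !expect_union -big_split; apply: ler_sum => j _ /=.
  have /andP[/ltW p0 _] := p01 j; rewrite -mulrDr ler_wpM2l //.
  apply: le_trans (g'P j).2 _; apply: le_expect => [|x _].
    by have [] := lifting_fdist (lft j).
  exact: le_bigmax.
Qed.

Lemma lifting_sequence_achievable N (mu : nat -> multidist R A) :
  lifting_sequence step mu ->
  exists2 g : A -> R, forall a, achievable N a (g a) &
    \sum_(n < N) expect (mu n) reducible <= expect (mu 0) g.
Proof.
elim: N mu => [|N IH] mu muP.
  exists (fun=> 0) => [a|]; first exact: achievable0.
  rewrite big_ord0; apply: expect_ge0 => //.
  by have [] := lifting_fdist (muP 0).
have [n|g gP gle] := IH (fun n => mu n.+1); first exact: muP.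
have [g' g'P g'le] := lifting_achievable (muP 0) gP; exists g' => //.
by rewrite big_ord_recl; apply: le_trans g'le; rewrite lerD2l.
Qed.

Lemma edlE (mu : nat -> multidist R A) : (forall n, is_fdist (mu n)) ->
  edl step mu = (\sum_(0 <= n <oo) (expect (mu n) reducible)%:E)%E.
Proof.
by move=> muP; apply: eq_eseriesr => n _; rewrite expect_reducible.
Qed.

Lemma unbounded_achievable a :
  ~ (ereal_sup [set edl step mu | mu in
       [set mu | lifting_sequence step mu /\ mu 0%N = md_dirac R a]] < +oo)%E ->
  forall c, exists n, achievable n a c.
Proof.
move=> /negP; rewrite -leNgt leye_eq => /eqP supE c.
have : (c%:E < +oo)%E by rewrite ltry.
rewrite -supE => /ereal_sup_gt[_ [mu [muP mu0] <-] clt].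
have fmu n : is_fdist (mu n) by have [] := lifting_fdist (muP n).
rewrite edlE // in clt.
have [[N cN]|noN] := pselect (exists N, c <= \sum_(n < N) expect (mu n) reducible).
  have [g gP gle] := lifting_sequence_achievable N muP; exists N.
  rewrite mu0 expect_dirac in gle.
  exact: achievable_le (le_trans cN gle) (gP a).
(* If no partial sum reaches [c], then neither does their limit exceed it, against the choice of
   [mu]. *)
exfalso; move: clt; rewrite ltNge => /negP; apply.
apply: lime_le.
  by apply: is_cvg_nneseries => n _ _; rewrite lee_fin expect_ge0 // => ?; exact: reducible_ge0.
apply: nearW => N; rewrite sumEFin lee_fin big_mkord leNgt; apply/negP => clt.
by apply: noN; exists N; apply: ltW.
Qed.

(** * Markov chains whose projections are lifting sequences *)

Section Scheduler.
Variables (S : choiceType) (proj : S -> A) (next : S -> multidist R S).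
Hypothesis next_lifting :
  forall s, lifting step (md_dirac R (proj s)) (md_map proj (next s)).

Definition run (s : S) (n : nat) : multidist R S :=
  iter n (fun mu => md_bind mu next) (md_dirac R s).

(** Expected number of proper steps among the first [N], by first-step analysis; [gainE] identifies
    it with a partial sum of the expected derivation length. *)
Fixpoint gain (N : nat) (s : S) : R :=
  if N is N'.+1 then reducible (proj s) + expect (next s) (gain N') else 0.

Lemma next_fdist s : is_fdist (next s).
Proof. exact/(is_fdist_map proj)/(lifting_fdist (next_lifting s)).2. Qed.

Lemma gain_ge0 N s : 0 <= gain N s.
Proof.
elim: N s => //= N IH s; apply: addr_ge0; first exact: reducible_ge0.
exact: expect_ge0 (next_fdist s) IH.
Qed.

Lemma le_gain : {homo gain : M N / (M <= N)%N >-> forall s, M s <= N s}.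
Proof.
move=> M N + s; elim: M N s => [|M IH] [|N] s //= MN; first exact: (gain_ge0 N.+1).
by rewrite lerD2l; apply: le_expect (next_fdist s) _ => x _; exact: IH.
Qed.

(** The two claims are proved together: validity of the law gives the next lifting step, and that
    step gives validity of the next law. *)
Lemma run_fdist_lifting s n : is_fdist (run s n) /\
  lifting step (md_map proj (run s n)) (md_map proj (run s n.+1)).
Proof.
have H mu : is_fdist mu ->
    lifting step (md_map proj mu) (md_map proj (md_bind mu next)).
  (* The projection of [mu] is a composition with Dirac laws, so both sides become compositions over
     the same [mu]. *)
  move=> muP; rewrite md_map_bind -md_bind_dirac.
  exact: lifting_bind.
elim: n => [|n [_ IH]].
  by have d := is_fdist_dirac R s; split; last exact: H.
have d : is_fdist (run s n.+1) by apply/(is_fdist_map proj)/(lifting_fdist IH).2.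
by split; last exact: H.
Qed.

Lemma gainE N s :
  gain N s = \sum_(n < N) expect (md_map proj (run s n)) reducible.
Proof.
(* The induction needs an arbitrary initial law, since a single step already leaves the Dirac
   ones. *)
suff H mu : expect mu (gain N) = \sum_(n < N)
    expect (md_map proj (iter n (fun mu => md_bind mu next) mu)) reducible.
  by rewrite -H expect_dirac.
elim: N mu => [|N IH] mu /=.
  by rewrite big_ord0 /expect big1 // => x _; rewrite mulr0.
rewrite big_ord_recl /= expect_map [LHS](expectD mu (reducible \o proj)); congr (_ + _).
rewrite -expect_bind IH; apply: eq_bigr => n _ /=.
by rewrite -iterSr.
Qed.

Lemma PAST_gain_bounded s : PAST step -> exists B : R, forall N, gain N s <= B.
Proof.
move=> past; have H := run_fdist_lifting s.
have := past (proj s) (fun n => md_map proj (run s n)).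
move=> /(_ (fun n => (H n).2) (md_map_dirac _ _ _)).
have fd n : is_fdist (md_map proj (run s n)) by apply/is_fdist_map/(H n).1.
rewrite edlE //.
have ge0 : (forall n, (0 <= n)%N -> true ->
    0 <= (expect (md_map proj (run s n)) reducible)%:E)%E.
  by move=> n _ _; rewrite lee_fin expect_ge0 // => ?; exact: reducible_ge0.
(* Being nonnegative and below [+oo], the series has a real value, which bounds its partial sums. *)
move: (nneseries_ge0 ge0) (fun k => @nneseries_lim_ge _ _ _ _ k ge0).
case: (X in (X < +oo)%E) => // B _ HB _; exists B => N.
by have := HB N; rewrite sumEFin lee_fin gainE big_mkord.
Qed.

End Scheduler.
End AbstractReduction.

(** * States that carry a pending strategy *)

Section Strategies.
Variables (R : realType) (A : choiceType) (step : A -> multidist R A -> Prop).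
Hypothesis step_fdist : forall a mu, step a mu -> is_fdist mu.
Variables (T : choiceType) (lab : T -> A).

(* A state [inr (n, a, c)] is at [a] and has to collect [c] proper steps in
   expectation during its next [n] steps. *)
Notation state := (T + nat * A * R)%type.

Definition state_label (s : state) : A :=
  match s with inl v => lab v | inr (_, a, _) => a end.

(** The second clause is conditional on achievability, so that a suitable [mu] exists for every [n],
    [a] and [c] and [next] can be chosen for all states at once. *)
Definition pursues (n : nat) (a : A) (c : R) (mu : multidist R state) : Prop :=
  lifting step (md_dirac R a) (md_map state_label mu) /\
  (achievable step n a c -> c <= 0 \/
   exists n' f nu, [/\ n = n'.+1, step a nu,
     mu = md_map (fun b => inr (n', b, f b)) nu,
     forall x, x \in nu -> achievable step n' x.2 (f x.2) &
     c <= 1 + expect nu f]).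

Lemma md_map_state_label (n : nat) (f : A -> R) (nu : multidist R A) :
  md_map state_label (md_map (fun b => inr (n, b, f b)) nu) = nu.
Proof.
rewrite md_map_comp /md_map -[RHS]seq_mset_id; congr seq_mset.
by rewrite -[RHS]map_id; apply: eq_map => -[].
Qed.

Lemma pursues_total n a c : exists mu, pursues n a c mu.
Proof.
have [yes|no] := pselect (
    if n is n'.+1 then exists mu f, [/\ step a mu,
      forall x, x \in mu -> achievable step n' x.2 (f x.2) & c <= 1 + expect mu f]
    else False).
  case: n yes => // n' [nu [f [st fP cle]]].
  exists (md_map (fun b => inr (n', b, f b)) nu); split=> [|_].
    by rewrite md_map_state_label; apply: lifting_step.
  by right; exists n', f, nu; split.
(* Without a step witness, [c] is achievable only if nonpositive, so any lifting step will do; its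
   successors get a dummy budget and target. *)
have [nu lft] := lifting_total step a.
exists (md_map (fun b => inr (0%N, b, 0)) nu); split.
  by rewrite md_map_state_label.
by case: n no => [|n] no [|/no //]; left.
Qed.

(** The state [s] is arbitrary so that the result also covers a tree leaf [inl v], whose target is
    not stored in the state. After one step the successors are [inr] states with their own
    targets. *)
Lemma gain_pursues (next : state -> multidist R state) :
  (forall s, lifting step (md_dirac R (state_label s))
               (md_map state_label (next s))) ->
  (forall n a c, pursues n a c (next (inr (n, a, c)))) ->
  forall n s c, pursues n (state_label s) c (next s) ->
  achievable step n (state_label s) c -> c <= gain step state_label next n s.
Proof.
move=> nextP nextr; elim=> [|n IH] s c [_ sP] /[dup] cP /sP.
  by case: cP => // c0 _.
case=> [c0|[n' [f [nu [[<-] st nextE fP cle]]]]].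
  by apply: le_trans c0 _; exact: gain_ge0.
apply: le_trans cle _; rewrite /= (reducible_step st) lerD2l nextE expect_map.
apply: le_expect (step_fdist st) _ => x xnu /=.
by apply: IH; [exact: nextr|exact: fP].
Qed.

End Strategies.

(** * Rewriting and achievability inside a context *)

Section Contexts.
Variables (Sg : signature) (V : countType).
Implicit Types (s t u : term Sg V) (q : seq nat).

Lemma subterm_at_replace s q t u q' : subterm_at s q = Some t ->
  subterm_at (replace_at s q u) (q ++ q') = subterm_at u q'.
Proof.
elim: q s => [|i q IH] [x|f args] //=.
by case: insubP => // j _ ji; rewrite -ji eqxx => /IH.
Qed.

Lemma replace_at_replace s q t u q' r : subterm_at s q = Some t ->
  replace_at (replace_at s q u) (q ++ q') r = replace_at s q (replace_at u q' r).
Proof.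
elim: q s => [|i q IH] [x|f args] //=.
case: insubP => // j _ ji /IH E; congr App; apply/funext => l.
case: eqP => // li; have -> : l = j by apply/val_inj; rewrite /= li.
exact: E.
Qed.

Lemma replace_at_id s q t : subterm_at s q = Some t -> replace_at s q t = s.
Proof.
elim: q s => [|i q IH] [x|f args] //=; try by case.
case: insubP => // j _ ji /IH E; congr App; apply/funext => l.
case: eqP => // li; have -> : l = j by apply/val_inj; rewrite /= li.
exact: E.
Qed.

Variables (R : realType) (P : PTRS R Sg V).

Lemma fstep_fdist t mu : fstep P t mu -> is_fdist mu.
Proof. by move=> [q [l [nu [s [/rules_fdist ? _ ->]]]]]; apply/is_fdist_map. Qed.

Lemma fstep_context s q t u nu : subterm_at s q = Some t ->
  fstep P u nu -> fstep P (replace_at s q u) (md_map (replace_at s q) nu).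
Proof.
move=> sq [q' [l [mu [sg [rl uq ->]]]]]; exists (q ++ q'), l, mu, sg; split=> //.
  by rewrite (subterm_at_replace _ _ sq).
rewrite md_map_comp; congr md_map; apply/funext => r /=.
by rewrite (replace_at_replace _ _ _ sq).
Qed.

(** The strategy for [u] is replayed below position [q]. *)
Lemma achievable_context s q t n u c : subterm_at s q = Some t ->
  achievable (fstep P) n u c -> achievable (fstep P) n (replace_at s q u) c.
Proof.
move=> sq; have rK v : subterm_at (replace_at s q v) q = Some v.
  by have := subterm_at_replace v [::] sq; rewrite cats0 => ->.
elim: n u c => [|n IH] u c [c0|]; [by left|by []|by left|].
move=> [nu [f [st fP cle]]]; right; exists (md_map (replace_at s q) nu).
(* The target of a successor is read off its subterm at [q], which is the successor of [u] it comes
   from. *)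
exists (fun w => if subterm_at w q is Some v then f v else 0); split.
- exact: fstep_context sq st.
- move=> x; rewrite mem_seq_mset => /mapP[y ynu ->] /=; rewrite rK.
  exact/IH/fP.
- apply: le_trans cle _; rewrite lerD2l expect_map.
  by apply: le_expect (fstep_fdist st) _ => x _ /=; rewrite rK.
Qed.

Lemma achievable_subterm s t n c : contains_subterm s t ->
  achievable (fstep P) n t c -> achievable (fstep P) n s c.
Proof.
by move=> [q sq] /(achievable_context sq); rewrite (replace_at_id sq).
Qed.

End Contexts.

(** Serves to split leaf addresses according to the child subtree they enter. *)
Lemma size_sum_count (T : Type) (f : T -> nat) (n : nat) (s : seq T) :
  all (fun x => f x < n)%N s ->
  size s = (\sum_(0 <= i < n) count (fun x => f x == i) s)%N.
Proof.
elim: s => [|x s IH] /=; first by rewrite big1.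
move=> /andP[xn /IH ->]; rewrite big_split /= -add1n; congr addn.
rewrite big_mkord (bigD1 (Ordinal xn)) //= eqxx big1 // => i.
by rewrite -val_eqE /= eq_sym => /negbTE ->.
Qed.

(** * Scheduling along a rewrite sequence tree *)

Section Trees.
Variables (R : realType) (Sg : signature) (V : countType) (P : PTRS R Sg V).
Variable T : labeled_tree R Sg V.

Lemma is_node_rcons v i :
  is_node T v -> (i < nchildren T v)%N -> is_node T (rcons v i).
Proof.
move=> nv iv j; rewrite size_rcons ltnS leq_eqVlt nth_rcons => /predU1P[->|jv].
  by rewrite ltnn eqxx -cats1 take_size_cat.
by rewrite jv -cats1 takel_cat ?nv // ltnW.
Qed.

Lemma is_node_child v i w : is_node T (v ++ i :: w) -> (i < nchildren T v)%N.
Proof.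
move/(_ (size v)); rewrite size_cat addnS ltnS leq_addr.
by rewrite nth_cat ltnn subnn take_size_cat //; apply.
Qed.

Hypothesis T_RST : is_RST P T.

Lemma node_prob_gt0 v : is_node T v -> 0 < node_prob T v.
Proof. by case: T_RST => _ pP _ /pP /andP[]. Qed.

Notation state := (seq nat + nat * term Sg V * R)%type.
Notation label := (state_label (node_term T)).

(** Keeps the addresses of the children, because distinct nodes may carry the same term. *)
Definition children_states (v : seq nat) : multidist R state :=
  seq_mset [seq (node_prob T (rcons v i) / node_prob T v, inl (rcons v i))
           | i <- iota 0 (nchildren T v)].

Lemma md_map_children_states v :
  md_map label (children_states v) = children_dist T v.
Proof. by rewrite md_map_seq_mset -map_comp. Qed.

Variable rounds : seq nat -> nat.

(* Follow the tree; at a leaf [v], collect [1 / node_prob T v] proper steps in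
   expectation within [rounds v] steps, if possible. *)
Definition tree_scheduler (next : state -> multidist R state) : Prop :=
  [/\ forall s, lifting (fstep P) (md_dirac R (label s)) (md_map label (next s)),
      forall n a c, pursues (fstep P) (node_term T) n a c (next (inr (n, a, c))),
      forall v, is_node T v -> (0 < nchildren T v)%N ->
        next (inl v) = children_states v &
      forall v, is_leaf T v -> pursues (fstep P) (node_term T) (rounds v)
        (node_term T v) (node_prob T v)^-1 (next (inl v))].

Lemma tree_scheduler_exists : exists next, tree_scheduler next.
Proof.
have /choice[next nextP] : forall s : state, exists mu, match s with
    | inl v => lifting (fstep P) (md_dirac R (label s)) (md_map label mu) /\
      if `[< is_node T v /\ (0 < nchildren T v)%N >] then mu = children_states v
      else pursues (fstep P) (node_term T) (rounds v)
        (node_term T v) (node_prob T v)^-1 mu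
    | inr (n, a, c) => pursues (fstep P) (node_term T) n a c mu end.
  case=> [v|[[n a] c]]; last exact: pursues_total.
  case: asboolP => [[nv v0]|_].
    exists (children_states v); split=> //; rewrite md_map_children_states.
    by apply: lifting_step; case: T_RST => _ _; apply.
  have [mu muP] := pursues_total (fstep P) (node_term T) (rounds v)
    (node_term T v) (node_prob T v)^-1.
  by exists mu; split; first exact: muP.1.
exists next; split=> [s|n a c|v nv v0|v [nv v0]].
- have := nextP s; case: s => [v|[[n a] c]]; by case.
- exact: nextP (inr (n, a, c)).
- by have [_] := nextP (inl v); rewrite asboolT.
- by have [_] := nextP (inl v); rewrite asboolF // v0 => -[].
Qed.

Variable next : state -> multidist R state.
Hypothesis nextP : tree_scheduler next.

Let gain := gain (fstep P) label next.

(** [F] lists leaf addresses relative to [u]. Each leaf is reached within [m] steps and then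
    collects the inverse of its probability within [K] more, so it contributes at least 1. The proof
    descends one tree level at a time. *)
Lemma leaves_gain m K u (F : seq (seq nat)) : is_node T u -> uniq F ->
  (forall w, w \in F -> [/\ (size w <= m)%N, (rounds (u ++ w) <= K)%N,
     is_leaf T (u ++ w) & achievable (fstep P) (rounds (u ++ w))
       (node_term T (u ++ w)) (node_prob T (u ++ w))^-1]) ->
  (size F)%:R <= node_prob T u * gain (m + K) (inl u).
Proof.
have [nextL nextr nexti nextl] := nextP.
have gain0 N s : 0 <= gain N s := gain_ge0 (@fstep_fdist _ _ _ _) nextL N s.
have le_g := le_gain (@fstep_fdist _ _ _ _) nextL.
(* At a leaf the only possible relative address is the empty one, so [E] has at most one element. *)
have at_leaf M v E : nchildren T v = 0%N -> is_node T v -> uniq E ->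
    (forall w, w \in E -> [/\ (rounds (v ++ w) <= M)%N,
      is_leaf T (v ++ w) & achievable (fstep P) (rounds (v ++ w))
        (node_term T (v ++ w)) (node_prob T (v ++ w))^-1]) ->
    (size E)%:R <= node_prob T v * gain M (inl v).
  move=> v0 nv uE EP; have pv := node_prob_gt0 nv.
  have Enil w : w \in E -> w = [::].
    by case: w => // i w /EP[_ [/is_node_child]]; rewrite v0.
  case: E uE EP Enil => [|w E] uE EP Enil; first by rewrite mulr_ge0 // ltW.
  have wE : w = [::] by apply: Enil; rewrite mem_head.
  have Enil2 : E = [::].
    case: E uE EP Enil => // w' E; rewrite /= inE negb_or => /andP[/andP[/eqP ww' _] _].
    by move=> _ Enil; case: ww'; rewrite wE [w']Enil // !inE eqxx orbT.
  have [+ lv] := EP w (mem_head _ _); rewrite {}Enil2 {}wE cats0 in lv * => rM ach.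
  rewrite -[leLHS](mulfV (lt0r_neq0 pv)) ler_pM2l //.
  apply: le_trans (le_g _ _ rM _); apply: gain_pursues => //; first exact: fstep_fdist.
  exact: nextl.
elim: m u F => [|m IH] u F nu uF FP.
all: have [u0|u0] := posnP (nchildren T u).
- by apply: at_leaf => // w /FP[].
(* At depth 0 below an inner node there is no leaf, so [F] is empty. *)
- case: F {uF} FP => [_|w F /(_ w (mem_head _ _))[]].
    by rewrite mulr_ge0 // ltW // node_prob_gt0.
  by case: w => // _ _ [_]; rewrite cats0 => uE; rewrite uE in u0.
- apply: at_leaf => // w /FP[_ ? ? ?]; split=> //.
  by apply: leq_trans (leq_addl _ _).
have pu := node_prob_gt0 nu.
have FN w : w \in F -> w = head 0%N w :: behead w.
  case: w => //= /FP[_ _ [_]]; rewrite cats0 => uE; by rewrite uE in u0.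
have Fhead : all (fun w => head 0 w < nchildren T u)%N F.
  apply/allP => w wF; have [_ _ [+ _] _] := FP w wF.
  by rewrite {1}(FN w wF) => /is_node_child.
rewrite (size_sum_count Fhead) natr_sum addSn /gain /= -/gain nexti //.
rewrite mulrDr /children_states /expect big_seq_mset big_map mulr_sumr.
(* The step made at [u] itself is discarded; the gains of the children suffice. *)
apply: ler_wpDl; first by rewrite mulr_ge0 ?reducible_ge0 // ltW.
rewrite /index_iota subn0 big_seq [leRHS]big_seq; apply: ler_sum => i.
rewrite mem_iota add0n /= => iu.
rewrite mulrA [node_prob T u * _]mulrC divfK ?lt0r_neq0 //.
(* The addresses entering child [i], with that first index removed, satisfy the induction hypothesis
   at the child. *)
rewrite -size_filter.
rewrite -(size_map behead); apply: IH.
- exact: is_node_rcons.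
- rewrite map_inj_in_uniq ?filter_uniq // => w w'.
  rewrite !mem_filter => /andP[/eqP wi /FN ->] /andP[/eqP wi' /FN ->] /= ->.
  by rewrite wi wi'.
- move=> _ /mapP[w + ->]; rewrite mem_filter => /andP[/eqP wi wF].
  have -> : rcons u i ++ behead w = u ++ w by rewrite cat_rcons -wi -(FN w wF).
  have [wm ? ? ?] := FP w wF; split; rewrite // size_behead.
  by case: size wm.
Qed.

End Trees.

Theorem theorem3p19 (R : realType) (Sg : signature) (V : countType)
    (P : PTRS R Sg V) :
  admits_infinite_splits P -> (PAST (fstep P) <-> SAST (fstep P)).
Proof.
move=> splits; split=> [past t|sast t mu muP mu0]; last first.
  by apply: le_lt_trans (sast t); apply: ereal_sup_ubound; exists mu.
apply: contrapT => /(unbounded_achievable (@fstep_fdist _ _ _ P)) ach.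
have [t' [T [TR _ inf]]] := splits t.
have /choice[rounds roundsP] : forall v, exists n,
    achievable (fstep P) n t (node_prob T v)^-1 by move=> v; exact: ach.
have [next nextP] := tree_scheduler_exists TR rounds.
have [nextL _ _ _] := nextP.
have [B BP] := PAST_gain_bounded (@fstep_fdist _ _ _ P) nextL (inl [::]) past.
(* More than [B] leaves, finitely many, so that a common depth and a common number of rounds bound
   them all. *)
have [F FP FB] := infinite_set_fset (Num.truncn B).+1 inf.
have := @leaves_gain _ _ _ _ _ TR rounds _ nextP (\max_(w <- F) size w)%N
  (\max_(w <- F) rounds w)%N [::] F.
have [-> _ _] := TR; rewrite mul1r => Fle.
have {Fle} Fle := le_trans (Fle _ (fset_uniq F) _) (BP _).
suff : (size F)%:R <= B.
  apply/negP; rewrite -ltNge.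
  by apply: lt_le_trans (truncnS_gt B) _; rewrite ler_nat.
apply: Fle => // w wF; have [lw cw] := FP w wF; split=> //.
- exact: leq_bigmax_seq.
- exact: leq_bigmax_seq.
- exact: achievable_subterm cw (roundsP w).
Qed.
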